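(* Let $T>0$, $m\in\mathbb{N}$, and let $\{x^n\}_{n\in\mathbb{N}}\subset\mathcal{D}([0,T],\mathbb{R}^m)$ be uniformly bounded in total variation, i.e. $\sup_n V(x^n,T)<\infty$. For each $n$ define $$r^n(t)=\frac{t+V(x^n,t)}{T+V(x^n,T)},\quad t\in[0,T],\qquad \hat r^n(s)=\inf\{u\ge0: r^n(u)>s\}\wedge T,\quad s\in[0,1],$$ and let $\hat x^n:[0,1]\to\mathbb{R}^m$ be the associated time-scaled function defined by linear interpolation over jumps (see context). Then the sequence $\{(\hat x^n,\hat r^n)\}_n$ is relatively compact under the uniform topology. Consider a limit point $(\hat x,\hat r)$, attained via a subsequence $\{n_k\}$, and set $r(t)=\inf\{s\ge0:\hat r(s)>t\}\wedge1$ for $t\in[0,T]$. Then: (1) for $x\in\mathcal{D}([0,T],\mathbb{R}^m)$, $\lim_{n\to\infty}d_w(x^n,x)=0$ implies that $\hat x\circ r=x$; (2) if in addition each $x^n$ is nondecreasing component-wise, then $(\hat x,\hat r)$ is a weak parametric representation of $x:=\hat x\circ r$, and consequently $\lim_{n\to\infty}d_w(x^n,x)=0$.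
   Context: $\mathcal{D}([0,T],\mathbb{R}^m)$ is the space of functions $[0,T]\to\mathbb{R}^m$ that are right-continuous with left limits; convention $x(0-)=x(0)$. $V(x,t)$ is the total variation of $x$ on $[0,t]$. The infimum of the empty set is $\infty$. For $a,b\in\mathbb{R}^m$ let $[[a,b]]=\prod_{i=1}^m[a_i\wedge b_i,a_i\vee b_i]$. The thick graph of $x$ is $G(x)=\{(z,t)\in\mathbb{R}^m\times[0,T]: z\in[[x(t-),x(t)]]\}$. The weak (partial) order on $G(x)$: $(z^1,t^1)\le(z^2,t^2)$ if either $t^1<t^2$, or $t^1=t^2$ and $|x_i(t^1-)-z^1_i|\le|x_i(t^1-)-z^2_i|$ for all $i$. A weak parametric representation of $x$ is a continuous function $(\hat x,\hat r):[0,1]\to G(x)$, nondecreasing with respect to the weak order, with $(\hat x(0),\hat r(0))=(x(0),0)$ and $(\hat x(1),\hat r(1))=(x(T),T)$. Let $\Pi_w(x)$ be the set of all weak parametric representations of $x$ and $$d_w(x^1,x^2)=\inf_{(\hat x^j,\hat r^j)\in\Pi_w(x^j),\,j=1,2}\Big\{\sup_{0\le s\le1}|\hat x^1(s)-\hat x^2(s)|\vee\sup_{0\le s\le1}|\hat r^1(s)-\hat r^2(s)|\Big\}.$$ Convergence in $d_w$ is convergence in the weak-M1 (WM1) topology. Definition of $\hat x^n$: for $s\in[0,1]$ such that $\hat r^n(s)$ is a continuity point of $x^n$, $\hat x^n(s)=x^n(\hat r^n(s))$. If $t$ is a discontinuity point of $x^n$, then $\hat r^n\equiv t$ on the interval $[r^n(t-),r^n(t)]$,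 and on this interval $\hat x^n$ is the linear interpolation between $\hat x^n(r^n(t-))=x^n(t-)$ and $\hat x^n(r^n(t))=x^n(t)$. Then $(\hat x^n,\hat r^n)$ is a weak parametric representation of $x^n$.
   Formalization: Relative compactness is stated for bounded {x^n(0)} (x^n≡n refutes it otherwise); in (2) the representation and d_w claims assume x̂(0)=x̂(r(0)) (x^n=1_{t≥T/n} refutes them), and d_w→0 holds along n_k, as alternating sequences refute the full limit. *)

(* Defs.v *)
From HB Require Import structures.
From mathcomp Require Import all_boot all_order all_algebra.
From mathcomp Require Import all_classical all_reals all_analysis.

Set Implicit Arguments.
Unset Strict Implicit.
Unset Printing Implicit Defensive.

Import Order.TTheory GRing.Theory Num.Theory.
Import numFieldNormedType.Exports.

Local Open Scope classical_set_scope.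
Local Open Scope ring_scope.

(* Functions on [0, b] are represented by functions on all of R; every
   definition below depends on their values on [0, b] only.  R^m is 'rV[R]_m
   with its library norm, the maximum norm. *)

(* f(t-), with the convention f(0-) = f(0). *)
Definition leftlim (R : realType) (V : ptopologicalType) (f : R -> V) (t : R)
    : V :=
  if t <= 0 then f t else lim (f u @[u --> t^'-]).

(* inf {u >= 0 : f(u) > s} /\ b for f defined on [0, b]; the infimum is taken
   in \bar R, so that it is +oo for the empty set (and the result is b). *)
Definition generalized_inverse (R : realType) (b : R) (f : R -> R) (s : R) : R :=
  fine (mine (ereal_inf [set u%:E | u in [set u | 0 <= u <= b /\ s < f u]])
             b%:E).

Section paths.
Context {R : realType} {m : nat}.
Implicit Types (T : R) (x : R -> 'rV[R]_m).

Definition cadlag T x : Prop :=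
  (forall t, 0 <= t < T -> x u @[u --> t^'+] --> x t) /\
  (forall t, 0 < t <= T -> cvg (x u @[u --> t^'-])).

Definition nondecreasing_path T x : Prop :=
  forall s t, 0 <= s -> s <= t -> t <= T ->
  forall i, x s ord0 i <= x t ord0 i.

(* V(x, t); the library's total_variation covers real-valued functions only. *)
Definition path_variation x (t : R) : \bar R :=
  ereal_sup [set (\sum_(0 <= k < size s)
                    `|x (nth t (0 :: s) k.+1) - x (nth t (0 :: s) k)|)%:E
            | s in itv_partition 0 t].

Definition thick_graph T x : set ('rV[R]_m * R) :=
  [set zt : 'rV[R]_m * R | 0 <= zt.2 <= T /\
    forall i, Num.min (leftlim x zt.2 ord0 i) (x zt.2 ord0 i) <= zt.1 ord0 i
              <= Num.max (leftlim x zt.2 ord0 i) (x zt.2 ord0 i)].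

Definition weak_le x (p q : 'rV[R]_m * R) : Prop :=
  p.2 < q.2 \/
  (p.2 = q.2 /\
   forall i, `|leftlim x p.2 ord0 i - p.1 ord0 i|
             <= `|leftlim x p.2 ord0 i - q.1 ord0 i|).

(* Pi_w(x) *)
Definition weak_param_reps T x : set (R -> 'rV[R]_m * R) :=
  [set p : R -> 'rV[R]_m * R | [/\ {within `[0, 1], continuous p},
    forall s, 0 <= s <= 1 -> thick_graph T x (p s),
    forall s s', 0 <= s -> s <= s' -> s' <= 1 -> weak_le x (p s) (p s'),
    p 0 = (x 0, 0) &
    p 1 = (x T, T)]].

Definition dw T x1 x2 : \bar R :=
  ereal_inf
    [set maxe (ereal_sup [set `|(pq.1 s).1 - (pq.2 s).1|%:E | s in `[0, 1]])
              (ereal_sup [set `|(pq.1 s).2 - (pq.2 s).2|%:E | s in `[0, 1]])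
    | pq in weak_param_reps T x1 `*` weak_param_reps T x2].

(* r^n, for x = x^n *)
Definition time_change T x (t : R) : R :=
  (t + fine (path_variation x t)) / (T + fine (path_variation x T)).

(* \hat r^n *)
Definition scaled_time T x : R -> R := generalized_inverse T (time_change T x).

(* \hat x^n.  For a cadlag x, t in [0, T] is a continuity point of x iff
   x(t-) = x(t).  Otherwise s lies in [r(t-), r(t)], where the linear
   interpolation between (r(t-), x(t-)) and (r(t), x(t)) is taken. *)
Definition scaled_path T x (s : R) : 'rV[R]_m :=
  let t := scaled_time T x s in
  let r := time_change T x in
  if leftlim x t == x t then x t
  else leftlim x t +
       ((s - leftlim r t) / (r t - leftlim r t)) *: (x t - leftlim x t).

Definition scaled_pair T x (s : R) : 'rV[R]_m * R :=
  (scaled_path T x s, scaled_time T x s).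

End paths.

(* Main.v *)
(** With K = T + V(x, T), any rescaled pair (\hat x, \hat r) of a path x is
    K-Lipschitz, because the increments of x and of time are both bounded by
    those of K r.  Relative compactness is then Ascoli's theorem.

    A limit point is Lipschitz as well.  If d_w(x^n, y) -> 0 then, for n large,
    x^n is uniformly close to y(t) on compact subintervals of a small
    (t, t + d), hence so is \hat x at every s with t < \hat r(s) < t + d; such s accumulate
    at r(t), so that \hat x(r(t)) = y(t).  No continuity point of y and no
    countability argument is needed.

    If the x^n are nondecreasing then so is \hat x, and the order squeezes
    \hat x(s) between the left limit and the value of \hat x o r at
    \hat r(s): this is membership in the thick graph, and the weak order on
    the graph reduces to the monotonicity of \hat x. *)
Require Import Defs.
From mathcomp Require Import all_boot all_order all_algebra.
From mathcomp Require Import all_classical all_reals all_analysis.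
From mathcomp Require Import ring lra.
Import Order.TTheory GRing.Theory Num.Theory.
Import numFieldNormedType.Exports.
Local Open Scope classical_set_scope.
Local Open Scope ring_scope.
Set Implicit Arguments.
Unset Strict Implicit.
Unset Printing Implicit Defensive.

(** * Generalized inverses and variation *)

Section generalized_inverse_theory.
Context {R : realType} (b : R) (f : R -> R) (s : R).
Hypothesis b_ge0 : 0 <= b.

Let E := [set u%:E | u in [set u | 0 <= u <= b /\ s < f u]].
Let g := generalized_inverse b f s.

(** The infimum is at least 0 and the cap [b] is finite, so [fine] loses nothing. *)
Let gE : g%:E = mine (ereal_inf E) b%:E.
Proof.
rewrite /g /generalized_inverse -/E fineK//.
have E0 : (0 <= ereal_inf E)%E.
  by apply: le_ereal_inf_tmp => _ [u [/andP[u0 _] _] <-]; rewrite lee_fin.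
apply: (@fin_real _ _); rewrite (@lt_le_trans _ _ 0%E) ?ltNyr//=.
  by apply: le_lt_trans (ltry b); rewrite ge_min lexx orbT.
by rewrite le_min E0 lee_fin.
Qed.

Lemma generalized_inverse_itv : 0 <= g <= b.
Proof.
rewrite -!lee_fin gE ge_min lexx orbT andbT le_min lee_fin b_ge0 andbT.
by apply: le_ereal_inf_tmp => _ [u [/andP[u0 _] _] <-]; rewrite lee_fin.
Qed.

Lemma generalized_inverse_le u : 0 <= u <= b -> s < f u -> g <= u.
Proof.
move=> ub su; rewrite -lee_fin gE ge_min; apply/orP; left.
by apply: ereal_inf_lbound; exists u.
Qed.

Lemma generalized_inverse_ge u : 0 <= u < g -> f u <= s.
Proof.
move=> /andP[u0 ug]; have /andP[_ gb] := generalized_inverse_itv.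
rewrite leNgt; apply/negP => /(generalized_inverse_le (u := u)).
by rewrite u0 (le_trans (ltW ug) gb) leNgt ug => /(_ isT).
Qed.

(** Since [u <= b], the cap cannot be the term of the minimum below [u]; the infimum is, so a member
    of the set lies below [u]. *)
Lemma generalized_inverse_lt u : g < u <= b -> exists2 v, g <= v < u & s < f v.
Proof.
move=> /andP[gu ub].
have : (mine (ereal_inf E) b%:E < u%:E)%E by rewrite -gE lte_fin.
rewrite gt_min => /orP[|]; last by rewrite lte_fin ltNge ub.
move/ereal_inf_lt => [_ [v [vb sv] <-]]; rewrite lte_fin => vu.
by exists v => //; rewrite vu andbT generalized_inverse_le.
Qed.

End generalized_inverse_theory.

Section generalized_inverse_monotone.
Context {R : realType} (b : R) (f : R -> R).
Hypothesis b_ge0 : 0 <= b.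

Lemma generalized_inverse_homo :
  {homo generalized_inverse b f : s s' / s <= s'}.
Proof.
move=> s s' ss'; rewrite leNgt; apply/negP => lt.
have /andP[_ gb] := generalized_inverse_itv f s b_ge0.
have [|v /andP[v1 v2] fv] :=
    @generalized_inverse_lt _ b f s' b_ge0 (generalized_inverse b f s).
  by rewrite lt.
have /andP[v0 _] := generalized_inverse_itv f s' b_ge0.
have := @generalized_inverse_le _ b f s b_ge0 v.
rewrite (le_trans v0 v1) (le_trans (ltW v2) gb) leNgt v2.
by rewrite (le_lt_trans ss' fv) => /(_ isT isT).
Qed.

Lemma generalized_inverse_max s : (forall u, 0 <= u <= b -> f u <= s) ->
  generalized_inverse b f s = b.
Proof.
move=> fs; have /andP[g0] := generalized_inverse_itv f s b_ge0.
rewrite le_eqVlt => /predU1P[//|gb].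
have [|v /andP[v1 v2]] := @generalized_inverse_lt _ b f s b_ge0 b.
  by rewrite gb lexx.
by rewrite ltNge fs// (le_trans g0 v1) ltW.
Qed.

End generalized_inverse_monotone.

Section leftlim_theory.
Context {R : realType}.

Lemma leftlim_cvg (V : ptopologicalType) (f : R -> V) t : 0 < t ->
  cvg (f u @[u --> t^'-]) -> f u @[u --> t^'-] --> leftlim f t.
Proof. by move=> t0 ft; rewrite /leftlim leNgt t0. Qed.

Lemma leftlim0 (V : ptopologicalType) (f : R -> V) : leftlim f 0 = f 0.
Proof. by rewrite /leftlim lexx. Qed.

End leftlim_theory.

(** * Total variation along partitions *)

Section variation.
Context {R : realType} {m : nat}.
Implicit Types (x : R -> 'rV[R]_m) (s : seq R).

(** The sum inside [path_variation], by recursion with an explicit starting point so that it splits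
    over concatenations. *)
Fixpoint path_sum x a s : R :=
  if s is b :: s' then `|x b - x a| + path_sum x b s' else 0.

Lemma path_sum_cat x a s1 s2 :
  path_sum x a (s1 ++ s2) = path_sum x a s1 + path_sum x (last a s1) s2.
Proof.
by elim: s1 a => [|b s1 ih] a /=; rewrite ?add0r// ih addrA.
Qed.

Lemma path_sumE x a t s :
  \sum_(0 <= k < size s) `|x (nth t (a :: s) k.+1) - x (nth t (a :: s) k)| =
  path_sum x a s.
Proof.
elim: s a => [|b s ih] a; first by rewrite big_nil.
by rewrite big_nat_recl//= -ih.
Qed.

Lemma path_variationE x t : path_variation x t =
  ereal_sup [set (path_sum x 0 s)%:E | s in itv_partition 0 t].
Proof.
congr ereal_sup; apply: eq_imagel => s _.
by rewrite path_sumE.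
Qed.

Lemma path_sum_le_variation x t s :
  itv_partition 0 t s -> ((path_sum x 0 s)%:E <= path_variation x t)%E.
Proof. by move=> ps; rewrite path_variationE; apply: ereal_sup_ubound; exists s. Qed.

(** Appending [s] to any partition of [[0, a]] gives a partition of [[0, b]]. *)
Lemma path_variation_add x a b s : itv_partition a b s ->
  (path_variation x a + (path_sum x a s)%:E <= path_variation x b)%E.
Proof.
move=> pab; rewrite -leeBrDr// path_variationE; apply: ge_ereal_sup.
move=> _ [s0 p0a <-]; rewrite leeBrDr// -EFinD.
have /path_sum_le_variation := itv_partition_cat p0a pab.
move=> /(_ x); rewrite path_sum_cat.
by case: p0a => _ /eqP ->.
Qed.

Lemma path_variation0 x : path_variation x 0 = 0%E.
Proof.
rewrite path_variationE; apply/eqP; rewrite eq_le; apply/andP; split.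
  by apply: ge_ereal_sup => _ [s /itv_partitionxx -> <-].
by apply: ereal_sup_ubound; exists [::].
Qed.

Lemma le_path_variation x a b : a <= b ->
  (path_variation x a + `|x b - x a|%:E <= path_variation x b)%E.
Proof.
rewrite le_eqVlt => /predU1P[->|ab]; first by rewrite subrr normr0 adde0.
by have := path_variation_add x (itv_partition1 ab); rewrite /= addr0.
Qed.

(** Isolates the partition interval [[last a s1, c)] that contains [t]. *)
Lemma split_path (a t : R) s : path <%R a s -> a <= t < last a s ->
  exists s1 c s2, [/\ s = s1 ++ c :: s2, last a s1 <= t < c,
   path <%R a s1 & path <%R c s2].
Proof.
elim: s a => [|b s ih] a /=; first by move=> _ /andP[/le_lt_trans/[apply]]; rewrite ltxx.
move=> /andP[ab pb] /andP[at_ tl]; have [tb|bt] := ltP t b.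
  by exists [::], b, s => /=; rewrite at_ tb.
have [|s1 [c [s2 [-> ? p1 p2]]]] := ih b pb; first by rewrite bt.
by exists (b :: s1), c, s2; split=> //=; rewrite ab.
Qed.

End variation.

Section bounded_variation.
Context {R : realType} {m : nat} (T : R) (x : R -> 'rV[R]_m).
Hypothesis T_ge0 : 0 <= T.
Hypothesis x_bv : (path_variation x T < +oo)%E.

Let V t := fine (path_variation x t).

Lemma path_variation_ge0 t : 0 <= t -> (0 <= path_variation x t)%E.
Proof.
move=> /(le_path_variation x); rewrite path_variation0 add0e.
by apply: le_trans; rewrite lee_fin.
Qed.

Lemma path_variation_fin t : 0 <= t <= T -> path_variation x t \is a fin_num.
Proof.
move=> /andP[t0 tT]; rewrite ge0_fin_numE ?path_variation_ge0//.
apply: le_lt_trans x_bv; apply: le_trans (le_path_variation x tT).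
by rewrite leeDl// lee_fin.
Qed.

Lemma variation_incr a b : 0 <= a -> a <= b -> b <= T ->
  `|x b - x a| <= V b - V a.
Proof.
move=> a0 ab bT; have := le_path_variation x ab.
rewrite -(fineK (path_variation_fin (t := a) _)) ?a0 ?(le_trans ab)//.
rewrite -(fineK (path_variation_fin (t := b) _)) ?(le_trans a0)//.
by rewrite -EFinD lee_fin -/(V a) -/(V b); lra.
Qed.

(** Take a partition nearly attaining V(T) and let [l <= t < c] be its interval around [t]. For [u]
    in [(t, c)], replacing the step from [l] to [c] by steps through [t] and [u] does not decrease
    the sum. The part up to [t] is at most V(t), and the part after [u] is at most V(T) - V(u).
    Hence V(u) - V(t) is less than [e / 2] plus the norm of [x t - x u]. *)
Lemma variation_right_continuous t : 0 <= t < T ->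
  x u @[u --> t^'+] --> x t -> V u @[u --> t^'+] --> V t.
Proof.
move=> /andP[t0 tT] xt; apply/cvgrPdist_lt => e e0.
have e2 : 0 < e / 2 by rewrite divr_gt0.
have VTfin : path_variation x T \is a fin_num.
  by apply: path_variation_fin; rewrite T_ge0 lexx.
have [_ [s ps <-] Vs] := ub_ereal_sup_adherent e2
  (eq_ind _ (fun y => y \is a fin_num) VTfin _ (path_variationE x T)).
rewrite -path_variationE -(fineK VTfin) -EFinB lte_fin -/(V T) in Vs.
have [s0 /eqP lT] := ps.
have [|s1 [c [s2 [sE /andP[lt tc] p1 p2]]]] := split_path s0 (t := t).
  by rewrite t0 lT.
set l := last 0 s1 in lt.
have l0 : 0 <= l by apply: (@itv_partition_le _ _ _ _ s1); split.
have lc : last c s2 = T by rewrite -lT sE last_cat.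
have cT : c <= T by apply: (@itv_partition_le _ _ _ _ s2); split; rewrite ?lc.
have S1 : path_sum x 0 s1 <= V l.
  have lT' : 0 <= l <= T by rewrite l0 (le_trans lt)// ltW.
  rewrite -lee_fin (fineK (path_variation_fin lT')).
  by apply: path_sum_le_variation; split.
have Vlt := variation_incr l0 lt (ltW tT).
near=> u.
have tu : t < u by near: u; exact: nbhs_right_gt.
have uc : u < c by near: u; exact: nbhs_right_lt.
have xtu : `|x t - x u| < e / 2.
  by near: u; move/cvgrPdist_lt : xt; exact.
have Vtu := variation_incr t0 (ltW tu) (le_trans (ltW uc) cT).
have V2 : V u + (`|x c - x u| + path_sum x c s2) <= V T.
  have u0 : 0 <= u <= T by rewrite (le_trans t0 (ltW tu)) (le_trans (ltW uc)).
  have := @path_variation_add _ _ x u T (c :: s2).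
  rewrite -(fineK VTfin) -(fineK (path_variation_fin u0)) -EFinD lee_fin; apply.
  by split; rewrite /= ?uc//= lc.
rewrite distrC ger0_norm; last first.
  by rewrite subr_ge0 -subr_ge0 (le_trans _ Vtu).
rewrite sE path_sum_cat /= -/l in Vs.
have tri : `|x c - x l| <= `|x t - x l| + (`|x t - x u| + `|x c - x u|).
  rewrite (distrC (x t) (x u)).
  rewrite (_ : x c - x l = (x t - x l) + ((x u - x t) + (x c - x u))).
    by rewrite (le_trans (ler_normD _ _))// lerD2l ler_normD.
  by apply/rowP => i; rewrite !mxE; lra.
lra.
Unshelve. all: by end_near. Qed.

End bounded_variation.

(** * Lipschitz estimate for the rescaled path *)

(** Bounds a partial step along an interpolated jump. For [d = 0] the quotient is 0 by convention
    and the bound is trivial. *)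
Lemma ler_norm_scale {R : realType} {m : nat} (K a d : R) (D : 'rV[R]_m) :
  0 <= a -> 0 <= d -> `|D| <= K * d -> 0 <= K -> `|(a / d) *: D| <= K * a.
Proof.
move=> a0; rewrite le_eqVlt => /predU1P[<- _ K0|d0 DK K0].
  by rewrite invr0 mulr0 scale0r normr0 mulr_ge0.
rewrite normrZ ger0_norm ?divr_ge0 ?(ltW d0)//.
have := ler_wpM2l (divr_ge0 a0 (ltW d0)) DK.
move/le_trans; apply; rewrite mulrCA divfK ?gt_eqF//.
Qed.

Section scaled.
Context {R : realType} {m : nat} (T : R) (x : R -> 'rV[R]_m).
Hypothesis T_gt0 : 0 < T.
Hypothesis x_cadlag : cadlag T x.
Hypothesis x_bv : (path_variation x T < +oo)%E.

Let T_ge0 : 0 <= T := ltW T_gt0.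
Let K := T + fine (path_variation x T).
Let r := time_change T x.

Lemma scale_gt0 : 0 < K.
Proof.
by rewrite ltr_pwDl//; exact/fine_ge0/path_variation_ge0.
Qed.
Let K_gt0 := scale_gt0.
Let K_ge0 := ltW scale_gt0.

Let KrE t : K * r t = t + fine (path_variation x t).
Proof. by rewrite /r /time_change mulrC divfK// gt_eqF. Qed.

(** [K * r t] is [t + V(t)], and increments of V dominate those of [x]. All Lipschitz bounds below
    come from this inequality and its left limits. *)
Lemma time_change_incr a b : 0 <= a -> a <= b -> b <= T ->
  (b - a) + `|x b - x a| <= K * (r b - r a).
Proof.
move=> a0 ab bT; have := variation_incr x_bv a0 ab bT.
by rewrite mulrBr !KrE; lra.
Qed.

Lemma time_change_homo a b : 0 <= a -> a <= b -> b <= T -> r a <= r b.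
Proof.
move=> a0 ab bT; rewrite -subr_ge0 -(pmulr_rge0 _ K_gt0).
apply: le_trans (time_change_incr a0 ab bT).
by rewrite addr_ge0// subr_ge0.
Qed.

Lemma time_change0 : r 0 = 0.
Proof. by rewrite /r /time_change path_variation0 addr0 mul0r. Qed.

Lemma time_change1 : r T = 1.
Proof. by rewrite /r /time_change divff// gt_eqF. Qed.

Lemma time_change_right_continuous t : 0 <= t < T -> r u @[u --> t^'+] --> r t.
Proof.
move=> tT; apply: cvgMl; apply: cvgD; first exact: cvg_at_right_filter.
by apply: (variation_right_continuous T_ge0 x_bv tT); apply: x_cadlag.1.
Qed.

Lemma time_change_left_cvg t : 0 < t <= T ->
  r u @[u --> t^'-] --> leftlim r t.
Proof.
move=> /andP[t0 tT]; apply: leftlim_cvg => //.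
apply: nondecreasing_at_left_is_cvgr; near=> y.
  have y0 : 0 < y by near: y; exact: nbhs_left_gt.
  move=> a b; rewrite !in_itv/= => /andP[ya at_] /andP[yb bt] ab.
  by rewrite time_change_homo ?(le_trans (ltW bt))// ltW// (lt_trans y0).
have y0 : 0 < y by near: y; exact: nbhs_left_gt.
exists (r t) => _ [a + <-]; rewrite /= in_itv/= => /andP[ya at_].
by rewrite time_change_homo ?(ltW at_)// ltW// (lt_trans y0).
Unshelve. all: by end_near. Qed.

Lemma path_left_cvg t : 0 < t <= T -> x u @[u --> t^'-] --> leftlim x t.
Proof.
by move=> tT; apply: leftlim_cvg; [case/andP: tT|exact: x_cadlag.2].
Qed.

Lemma time_change_incr_left u t : 0 <= u -> u < t -> t <= T ->
  (t - u) + `|leftlim x t - x u| <= K * (leftlim r t - r u).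
Proof.
move=> u0 ut tT; have t0 : 0 < t <= T by rewrite (le_lt_trans u0 ut).
apply: (@ler_cvg_to _ t^'- _ _ (fun v => (v - u) + `|x v - x u|)
   (fun v => K * (r v - r u))).
- apply: cvgD.
    by apply: cvgB; [exact: cvg_at_left_filter|exact: cvg_cst].
  by apply: cvg_norm; apply: cvgB; [exact: path_left_cvg|exact: cvg_cst].
- apply: cvgMr; apply: cvgB; [exact: time_change_left_cvg|exact: cvg_cst].
- near=> v; apply: time_change_incr => //.
    by apply: ltW; near: v; exact: nbhs_left_gt.
  by apply: le_trans tT; apply: ltW; near: v; exact: nbhs_left_lt.
Unshelve. all: by end_near. Qed.

Lemma time_change_jump t : 0 <= t <= T ->
  `|x t - leftlim x t| <= K * (r t - leftlim r t).
Proof.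
rewrite le_eqVlt => /andP[/predU1P[<-|t0] tT].
  by rewrite !leftlim0 !subrr normr0 mulr0.
apply: (@ler_cvg_to _ t^'- _ _ (fun v => `|x t - x v|)
   (fun v => K * (r t - r v))).
- by apply: cvg_norm; apply: cvgB; [exact: cvg_cst|apply: path_left_cvg; rewrite t0].
- by apply: cvgMr; apply: cvgB; [exact: cvg_cst|apply: time_change_left_cvg; rewrite t0].
- near=> v.
  have v0 : 0 <= v by apply: ltW; near: v; exact: nbhs_left_gt.
  have vt : v <= t by apply: ltW; near: v; exact: nbhs_left_lt.
  by apply: le_trans (time_change_incr v0 vt tT); rewrite lerDr subr_ge0.
Unshelve. all: by end_near. Qed.

Let tau := scaled_time T x.
Let X := scaled_path T x.

Lemma scaled_time_itv s : 0 <= tau s <= T.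
Proof. exact: generalized_inverse_itv. Qed.

Lemma scaled_time_homo : {homo tau : s s' / s <= s'}.
Proof. exact: generalized_inverse_homo. Qed.

(** Before the infimum [tau s] the values of [r] are at most [s]. With [le_time_change], this places
    [s] between [r(t-)] and [r(t)] at [t = tau s], so the interpolation weight is in [[0, 1]]. *)
Lemma leftlim_time_change_le s : 0 <= s -> leftlim r (tau s) <= s.
Proof.
move=> s0; have /andP[] := scaled_time_itv s.
rewrite le_eqVlt => /predU1P[<- _|t0 tT]; first by rewrite leftlim0 time_change0.
have t0T : 0 < tau s <= T by rewrite t0.
apply: (@ler_cvg_to _ (tau s)^'- _ _ r (cst s));
  [exact: time_change_left_cvg|exact: cvg_cst|].
near=> u; apply: (generalized_inverse_ge T_ge0); apply/andP; split.
  by apply: ltW; near: u; exact: nbhs_left_gt.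
by near: u; exact: nbhs_left_lt.
Unshelve. all: by end_near. Qed.

(** Arbitrarily close to the right of [tau s] there are points where [r] exceeds [s];
    right-continuity of [r] concludes. At [tau s = T], use [r T = 1]. *)
Lemma le_time_change s : s <= 1 -> s <= r (tau s).
Proof.
move=> s1; have /andP[t0] := scaled_time_itv s.
rewrite le_eqVlt => /predU1P[->|tT]; first by rewrite time_change1.
have t0T : 0 <= tau s < T by rewrite t0.
apply: (@ler_cvg_to _ (tau s)^'+ _ _ (cst s) r);
  [exact: cvg_cst|exact: time_change_right_continuous|].
near=> u.
have uT : u <= T by apply: ltW; near: u; exact: nbhs_right_lt.
have [|v /andP[v1 v2] /ltW sv] := @generalized_inverse_lt _ T r s T_ge0 u.
  by rewrite uT andbT; near: u; exact: nbhs_right_gt.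
by apply: le_trans sv _; rewrite time_change_homo ?(ltW v2)// (le_trans t0).
Unshelve. all: by end_near. Qed.

(** Since [K * r u >= u], the function [r] is positive at every positive time, whereas it would be
    at most 0 at half of a positive [tau 0]. *)
Lemma scaled_time0 : tau 0 = 0.
Proof.
have /andP[t0 tT] := scaled_time_itv 0.
apply/eqP; rewrite eq_le t0 andbT leNgt; apply/negP => t_gt0.
have h0 : 0 < tau 0 / 2 by rewrite divr_gt0.
have h1 : tau 0 / 2 < tau 0 by rewrite ltr_pdivrMr// ltr_pMr// ltr1n.
have := @generalized_inverse_ge _ T r 0 T_ge0 (tau 0 / 2).
rewrite (ltW h0) h1 => /(_ isT).
have := time_change_incr (lexx 0) (ltW h0) (le_trans (ltW h1) tT).
rewrite time_change0 !subr0 => h2 h3.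
have := le_trans h2 (mulr_ge0_le0 K_ge0 h3).
by apply/negP; rewrite -ltNge ltr_pwDl.
Qed.

Lemma scaled_time1 : tau 1 = T.
Proof.
apply: generalized_inverse_max => // u /andP[u0 uT].
by rewrite -time_change1 time_change_homo.
Qed.

(** At a continuity point the interpolated term vanishes, so one formula covers both cases of the
    definition. *)
Lemma scaled_pathE s : let t := tau s in X s =
  leftlim x t + ((s - leftlim r t) / (r t - leftlim r t)) *: (x t - leftlim x t).
Proof.
rewrite /= /X /scaled_path -/tau -/r.
by case: eqP => // ->; rewrite subrr scaler0 addr0.
Qed.

Lemma time_change_jump_ge0 t : 0 <= t <= T -> 0 <= r t - leftlim r t.
Proof.
move=> /time_change_jump /(le_trans (normr_ge0 _)).
by rewrite pmulr_rge0.
Qed.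

Lemma scaled_path_left s : 0 <= s ->
  `|X s - leftlim x (tau s)| <= K * (s - leftlim r (tau s)).
Proof.
move=> s0; rewrite scaled_pathE addrAC subrr add0r.
apply: ler_norm_scale => //; last exact: time_change_jump (scaled_time_itv s).
- by rewrite subr_ge0 leftlim_time_change_le.
- exact: time_change_jump_ge0 (scaled_time_itv s).
Qed.

Lemma scaled_path_convex s : 0 <= s <= 1 -> exists2 l, 0 <= l <= 1 &
  X s = leftlim x (tau s) + l *: (x (tau s) - leftlim x (tau s)).
Proof.
move=> /andP[s0 s1]; rewrite scaled_pathE; eexists; last by [].
have L0 := time_change_jump_ge0 (scaled_time_itv s).
have Ls := leftlim_time_change_le s0.
have sr := le_time_change s1.
move: L0; rewrite le_eqVlt => /predU1P[<-|L0].
  by rewrite invr0 mulr0 lexx ler01.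
rewrite divr_ge0 ?(ltW L0) ?subr_ge0//=.
by rewrite ler_pdivrMr// mul1r lerD2r.
Qed.

Lemma scaled_path_right s : 0 <= s <= 1 ->
  `|x (tau s) - X s| <= K * (r (tau s) - s).
Proof.
move=> /andP[s0 s1]; rewrite scaled_pathE opprD addrA.
have tT := scaled_time_itv s; set t := tau s in tT *.
have L0 := time_change_jump_ge0 tT; have J := time_change_jump tT.
move: (L0); rewrite le_eqVlt => /predU1P[L|L1].
  move: J; rewrite -L mulr0 normr_le0 => /eqP ->.
  by rewrite scaler0 subrr normr0 mulr_ge0// subr_ge0 le_time_change.
rewrite -{1}[x t - leftlim x t]scale1r -scalerBl.
rewrite -{1}(@divff _ (r t - leftlim r t)) ?gt_eqF// -mulrBl.
rewrite (_ : _ - _ - (s - _) = r t - s); last by ring.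
by apply: ler_norm_scale => //; rewrite subr_ge0 le_time_change.
Qed.

(** If [tau s = tau s'], both points lie on one interpolated jump, whose slope is at most [K].
    Otherwise go from [X s] to [x (tau s)], then to the left limit at [tau s'], then to [X s']. The
    three bounds are [K] times consecutive differences of [s <= r(tau s) <= r(tau s' -) <= s'], and
    they telescope. The middle one also bounds the time increment. *)
Lemma scaled_lipschitz s s' : 0 <= s -> s <= s' -> s' <= 1 ->
  `|X s' - X s| <= K * (s' - s) /\ `|tau s' - tau s| <= K * (s' - s).
Proof.
move=> s0 ss' s1; have tt' := scaled_time_homo ss'.
have s'0 := le_trans s0 ss'; have s1' := le_trans ss' s1.
have /andP[t0 tT] := scaled_time_itv s.
have /andP[t0' tT'] := scaled_time_itv s'.
move: tt'; rewrite le_eqVlt => /predU1P[tt'|tt'].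
  rewrite !scaled_pathE -tt' subrr normr0; split; last by rewrite mulr_ge0// subr_ge0.
  rewrite opprD addrACA subrr add0r -scalerBl -mulrBl.
  rewrite (_ : _ - _ - (s - _) = s' - s); last by ring.
  have tT2 : 0 <= tau s <= T by rewrite t0.
  apply: ler_norm_scale => //.
  - by rewrite subr_ge0.
  - exact: time_change_jump_ge0.
  - exact: time_change_jump.
have s01 : 0 <= s <= 1 by rewrite s0.
have A := scaled_path_right s01.
have B := scaled_path_left s'0.
have C := time_change_incr_left t0 tt' tT'.
have D := leftlim_time_change_le s'0.
have E := le_time_change s1'.
have F := ler_wpM2l K_ge0 D.
have G := ler_wpM2l K_ge0 E.
rewrite !mulrBr in A B C *; split.
  rewrite -(subrKA (leftlim x (tau s'))) -(subrKA (x (tau s)) (leftlim x (tau s'))).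
  apply: (le_trans (ler_normD _ _)).
  have := ler_normD (leftlim x (tau s') - x (tau s)) (x (tau s) - X s).
  lra.
rewrite ger0_norm ?subr_ge0 ?(ltW tt')//.
have := normr_ge0 (leftlim x (tau s') - x (tau s)).
lra.
Qed.

Lemma scaled_path0 : X 0 = x 0.
Proof.
rewrite /X /scaled_path -/tau scaled_time0 leftlim0 eqxx//.
Qed.

Lemma scaled_path1 : X 1 = x T.
Proof.
have := @scaled_path_right 1; rewrite scaled_time1 time_change1 subrr mulr0.
rewrite lexx ler01 => /(_ isT); rewrite normr_le0 subr_eq0.
by move/eqP.
Qed.

End scaled.

(** * Compactness of sets of Lipschitz functions *)

(** Uniform convergence on [[a, b]] does not separate functions that differ only outside it, so a
    compact set there need not be closed. *)
Lemma compact_closure (X : uniformType) (K : set X) :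
  compact K -> compact (closure K).
Proof.
move=> cK F PF FK.
pose D (i : set X * set (X * X)) := F i.1 /\ entourage i.2.
(* The filter on [K] generated by entourage-thickenings of members of [F]; these meet [K] because
   [F] charges its closure. A cluster point in [K] of this filter is one of [F]. *)
pose B (i : set X * set (X * X)) :=
  K `&` [set z | exists2 y, i.1 y & i.2 (z, y)].
have PG : ProperFilter (filter_from D B).
  apply: filter_from_proper.
    apply: filter_from_filter; first by exists (setT, setT); split; exact: filterT.
    move=> [U E] [U' E'] [/= FU eE] [/= FU' eE']; exists (U `&` U', E `&` E').
      by split; exact: filterI.
    by move=> z [Kz [y [Uy Uy'] [Ey Ey']]]; split; split=> //; exists y.
  move=> [U E] [/= FU eE]; have [z [Uz clz]] := filter_ex (filterI FU FK).
  have /clz[k [Kk /xsectionP kz]] : nbhs z (xsection E^-1%relation z).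
    exact/nbhs_entourage/entourage_inv.
  by exists k; split => //; exists z.
have [|p [Kp pG]] := cK _ PG.
  by exists (setT, setT); [split; exact: filterT | move=> z []].
exists p; split; first exact: subset_closure.
move=> A C FA; rewrite -nbhs_entourageE => -[E eE EC].
have [||z [[Kz [y Ay zy]] /xsectionP pz]] :=
    pG (B (A, split_ent E)) (xsection (split_ent E) p).
- by exists (A, split_ent E) => //; split => //=; exact: entourage_split_ent.
- exact: nbhs_entourage.
exists y; split => //; apply/EC/xsectionP.
by apply: subset_split_ent => //; exists z.
Qed.

Section lipschitz_compactness.
Context {R : realType} {V : normedModType R} (a b L : R).

(** Precomposing with this retraction onto [[a, b]] keeps Lipschitz bounds and yields functions
    controlled on the whole line, where Ascoli's theorem is applied. *)
Let clamp (s : R) : R := Num.max a (Num.min b s).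

Let clamp_itv s : a <= b -> a <= clamp s <= b.
Proof.
by move=> ab; rewrite /clamp le_max lexx ge_max ab ge_min lexx.
Qed.

Let clampE s : a <= s <= b -> clamp s = s.
Proof. by move=> /andP[as_ sb]; rewrite /clamp (min_r sb) (max_r as_). Qed.

Let clamp_lip s s' : `|clamp s - clamp s'| <= `|s - s'|.
Proof.
rewrite /clamp ler_norml.
by case: (ger0P (s - s')) => ?; case: (leP b s) => ?; case: (leP b s') => ?;
  rewrite /Order.max; do ![case: ifPn; rewrite -?leNgt => ?];
  apply/andP; split; lra.
Qed.

(** Ascoli gives compactness of the closure of the clamped family for uniform convergence on compact
    sets. This passes to uniform convergence on [[a, b]], where each function is indistinguishable
    from its clamped version. *)
Lemma lipschitz_precompact (W : set (R -> V)) (C : set V) : a <= b -> 0 <= L ->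
  compact C ->
  (forall f s, W f -> a <= s <= b -> C (f s)) ->
  (forall f s s', W f -> a <= s <= b -> a <= s' <= b ->
     `|f s - f s'| <= L * `|s - s'|) ->
  precompact (W : set {uniform` `[a, b] -> V}).
Proof.
move=> ab L0 cC WC WL.
pose D : set (R -> V) := [set f \o clamp | f in W].
have pD : precompact (D : set {family compact, R -> V}).
  apply: pointwise_precompact_equicontinuous.
  - exact: norm_hausdorff.
  - move=> s; apply: (@precompact_subset _ _ C); last first.
      by apply: compact_precompact => //; exact: norm_hausdorff.
    by move=> _ [_ [f Wf <-] <-] /=; apply: WC => //; exact: clamp_itv.
  - move=> s E; rewrite -entourage_ballE => -[e /= e0 eE].
    (* Dividing by [L + 1] also covers [L = 0]. *)
    have eL : 0 < e / (L + 1) by rewrite divr_gt0// ltr_wpDl.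
    near=> s' => _ [f Wf <-] /=; apply: eE => /=.
    rewrite -ball_normE /= (le_lt_trans (WL _ _ _ Wf _ _))//; [exact: clamp_itv..|].
    apply: (le_lt_trans (ler_wpM2l L0 (clamp_lip _ _))).
    have : `|s - s'| < e / (L + 1).
      near: s'; exact: (@cvgr_dist_lt _ _ _ _ _ id s).
    rewrite ltr_pdivlMr ?ltr_wpDl// mulrC; apply: le_lt_trans.
    by rewrite ler_wpM2r// lerDl.
rewrite precompactE in pD; set K := closure _ in pD.
(* [[a, b]] is compact, so the uniform topology on it is coarser than the one of uniform convergence
   on compact sets. *)
have cK : compact (K : set {uniform` `[a, b] -> V}).
  move=> F PF FK; have [p [Kp Fp]] := pD F PF FK.
  exists p; split => // A B FA /uniform_nbhs[E [eE EB]].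
  apply: Fp => //; apply: filterS EB _; apply: fam_nbhs => //.
  exact: segment_compact.
exists (closure (K : set {uniform` `[a, b] -> V})); last first.
  by split; [exact: compact_closure|exact: closed_closure].
move=> f Wf B /uniform_nbhs[E [eE EB]]; exists (f \o clamp); split.
  by apply: subset_closure; exists f.
apply: EB => s /=; rewrite in_itv/= => sab; rewrite clampE//.
exact: entourage_refl.
Unshelve. all: by end_near. Qed.

End lipschitz_compactness.

Lemma compact_norm_ball {R : realType} {m : nat} (c : R) :
  compact [set p : 'rV[R]_m * R | `|p| <= c].
Proof.
have cV : compact [set v : 'rV[R]_m | `|v| <= c].
  apply: bounded_closed_compact.
    by exists c; split; [exact: num_real|move=> M cM v /= /le_trans; apply; exact: ltW].
  apply: (@closed_comp _ _ (fun v : 'rV[R]_m => `|v|) [set y : R | y <= c]).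
    by move=> v _; exact: norm_continuous.
  exact: closed_le.
have := compact_setX cV (@segment_compact _ (- c) c).
congr compact; apply/seteqP; split => -[v t] /=; rewrite in_itv/= -ler_norml prod_normE/=.
  by rewrite ge_max => -[-> ->].
by rewrite ge_max => /andP.
Qed.

(** * Thick graphs and the WM1 distance *)

Section row_norm.
Context {R : realType} {m : nat}.

Lemma row_norm_leP (v : 'rV[R]_m) e : 0 <= e ->
  (`|v| <= e) <-> (forall i, `|v ord0 i| <= e).
Proof.
move=> e0; rewrite [`|v|]mx_normrE; split=> [/bigmax_leP[_ h] i|h].
  exact: (h (ord0, i)).
by apply/bigmax_leP; split=> // -[i j] _ /=; rewrite (ord1 i).
Qed.

(** A closed ball of the maximum norm is a product of intervals, so it contains the box spanned by
    any two of its points. *)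
Lemma between_norm (a b c z : 'rV[R]_m) e :
  (forall i, Num.min (a ord0 i) (b ord0 i) <= z ord0 i
             <= Num.max (a ord0 i) (b ord0 i)) ->
  `|a - c| <= e -> `|b - c| <= e -> `|z - c| <= e.
Proof.
move=> zab ac bc; have e0 := le_trans (normr_ge0 _) ac.
move: ac bc => /(row_norm_leP _ e0) ac /(row_norm_leP _ e0) bc.
apply/(row_norm_leP _ e0) => i; move: (ac i) (bc i) (zab i).
rewrite !mxE !ler_norml => /andP[? ?] /andP[? ?].
by case: (leP (a ord0 i) (b ord0 i)) => _ /andP[? ?]; apply/andP; split; lra.
Qed.

Lemma cvg_row_coord (T : Type) (F : set_system T) (f : T -> 'rV[R]_m)
    (v : 'rV[R]_m) (i : 'I_m) :
  Filter F -> f u @[u --> F] --> v -> f u ord0 i @[u --> F] --> v ord0 i.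
Proof.
move=> FF fv; apply: (cvg_comp f (fun M : 'rV[R]_m => M ord0 i) fv).
exact: coord_continuous.
Qed.

End row_norm.

Lemma lipschitz_within_continuous {R : realType} {V : normedModType R}
    (a b L : R) (f : R -> V) :
  (forall s s', a <= s <= b -> a <= s' <= b ->
     `|f s - f s'| <= L * `|s - s'|) ->
  {within `[a, b], continuous f}.
Proof.
move=> fL; apply/subspace_continuousP => s /= sab.
apply/cvgrPdist_lt => e e0; rewrite near_withinE.
have eL : 0 < e / (`|L| + 1) by rewrite divr_gt0// ltr_wpDl.
near=> s' => /= s'ab; rewrite !in_itv/= in sab s'ab.
apply: le_lt_trans (fL _ _ sab s'ab) _.
have : `|s - s'| < e / (`|L| + 1).
  near: s'; exact: (@cvgr_dist_lt _ _ _ _ _ id s).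
rewrite ltr_pdivlMr ?ltr_wpDl// mulrC; apply: le_lt_trans.
by rewrite ler_wpM2r// (le_trans (ler_norm _))// lerDl.
Unshelve. all: by end_near. Qed.

Section graphs.
Context {R : realType} {m : nat} (T : R).
Implicit Types x y : R -> 'rV[R]_m.

Lemma leftlim_dist x t c e : cadlag T x -> 0 < t <= T ->
  (\forall u \near t^'-, `|x u - c| <= e) -> `|leftlim x t - c| <= e.
Proof.
move=> [_ xl] tT ue; have /andP[t0 _] := tT.
apply: (@ler_cvg_to _ t^'- _ _ (fun u => `|x u - c|) (cst e)) => //.
  apply: cvg_norm; apply: cvgB; last exact: cvg_cst.
  by apply: leftlim_cvg => //; exact: xl.
exact: cvg_cst.
Qed.

(** Just after [t], right-continuity keeps both [x u] and the left limit at [u] near [x t], hence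
    also the box they span. *)
Lemma thick_graph_right_near x t e : cadlag T x -> 0 <= t < T -> 0 < e ->
  exists2 d, 0 < d & forall z u, t < u -> u < t + d ->
    thick_graph T x (z, u) -> `|z - x t| <= e.
Proof.
move=> cx tT e0; have xt := cx.1 _ tT.
have [d /= d0 dx] := (cvgrPdist_lt _ _).1 xt _ e0.
have xd u : t < u -> u < t + d -> `|x u - x t| <= e.
  move=> tu ud; rewrite distrC ltW//; apply: dx => //=.
  by rewrite distrC ger0_norm ?subr_ge0 ?(ltW tu)// ltrBlDl.
exists d => // z u tu ud [/= /andP[u0 uT] zu].
apply: between_norm zu _ _; last exact: xd.
have t0 : 0 <= t by case/andP: tT.
apply: leftlim_dist => //; first by rewrite uT (le_lt_trans t0).
near=> v; apply: xd; first by near: v; exact: nbhs_left_gt.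
by apply: lt_trans ud; near: v; exact: nbhs_left_lt.
Unshelve. all: by end_near. Qed.

Lemma dw_ltP x y e : (dw T x y < e%:E)%E ->
  exists p q, [/\ weak_param_reps T x p, weak_param_reps T y q &
    forall s, 0 <= s <= 1 ->
      `|(p s).1 - (q s).1| <= e /\ `|(p s).2 - (q s).2| <= e].
Proof.
move=> /ereal_inf_lt[_ [[p q] [/= px qy] <-]]; rewrite gt_max => /andP[h1 h2].
exists p, q; split => // s s01; rewrite -!lee_fin; split.
  by apply: le_trans (ltW h1); apply: ereal_sup_ubound; exists s.
by apply: le_trans (ltW h2); apply: ereal_sup_ubound; exists s.
Qed.

Lemma weak_param_reps_surj x p t : weak_param_reps T x p -> 0 <= t <= T ->
  exists2 s, 0 <= s <= 1 & (p s).2 = t.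
Proof.
move=> [pc _ _ p0 p1] tT.
have [||s s01 ps] := @IVT R (snd \o p) 0 1 t ler01.
- apply/subspace_continuousP => s ss.
  apply: cvg_comp ((subspace_continuousP _ _).1 pc s ss) _.
  exact: cvg_snd.
- rewrite /= p0 p1 /= ; move: tT => /andP[t0 tT].
  by rewrite ge_min t0 le_max tT orbT.
by exists s => //; rewrite in_itv in s01.
Qed.

(* Every point of the graph of x is a limit of points of the thick graph with
   larger times, which a parametric representation must hit. *)
Lemma dw_path_near x y e eta a b c : cadlag T x ->
  (dw T x y < eta%:E)%E -> b <= T ->
  (forall z u, a < u -> u < b -> thick_graph T y (z, u) -> `|z - c| <= e) ->
  forall t, 0 <= t -> a + eta < t -> t < b - eta -> `|x t - c| <= e + eta.
Proof.
move=> cx /dw_ltP[p [q [xp yq pq]]] bT yab t t0 at_ tb.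
apply/ler_addgt0Pr => k k0.
have eta0 : 0 <= eta.
  by have [|/(le_trans (normr_ge0 _))] := pq 0; rewrite ?lexx ?ler01.
have tT : t < T by lra.
have [|d d0 xd] := @thick_graph_right_near x t k cx _ k0; first by rewrite t0.
(* [u] is close enough to [t] for [p] at time [u] to be near [x t], and is below [b - eta], so that
   [q] at the same parameter has its time in [(a, b)]. *)
pose u := Num.min (t + d / 2) ((t + (b - eta)) / 2).
have tu : t < u by rewrite lt_min; apply/andP; split; lra.
have ud : u < t + d by rewrite gt_min; apply/orP; left; lra.
have ub : u < b - eta by rewrite gt_min; apply/orP; right; lra.
have [|s s01 su] := weak_param_reps_surj xp (t := u).
  by apply/andP; split; lra.
have [pq1 pq2] := pq _ s01.
have [_ xg _ _ _] := xp; have [_ yg _ _ _] := yq.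
have h1 := xd (p s).1 (p s).2; rewrite -surjective_pairing in h1.
have {}h1 : `|(p s).1 - x t| <= k by apply: h1; rewrite ?su//; exact: xg.
have h2 := yab (q s).1 (q s).2; rewrite -surjective_pairing in h2.
have {}h2 : `|(q s).1 - c| <= e.
  move: pq2; rewrite su ler_norml => /andP[? ?].
  by apply: h2; [lra|lra|exact: yg].
rewrite -(subrKA (p s).1) -(subrKA (q s).1 (p s).1).
apply: le_trans (ler_normD _ _) _.
rewrite distrC in h1.
have := ler_normD ((p s).1 - (q s).1) ((q s).1 - c); lra.
Qed.

Lemma dw_path_end x y e : (dw T x y < e%:E)%E -> `|x T - y T| <= e.
Proof.
move=> /dw_ltP[p [q [[_ _ _ _ xp] [_ _ _ _ yq] pq]]].
by have [] := pq 1; rewrite ?ler01 ?lexx// xp yq.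
Qed.

(** [X] stays above the left limit, so distances to it are plain differences. The criterion serves
    both the rescaled pairs and their limit. *)
Lemma monotone_weak_param_rep x (X : R -> 'rV[R]_m) (tau : R -> R) (L : R) :
  (forall s s', 0 <= s <= 1 -> 0 <= s' <= 1 ->
     `|X s - X s'| <= L * `|s - s'|) ->
  (forall s s', 0 <= s <= 1 -> 0 <= s' <= 1 ->
     `|tau s - tau s'| <= L * `|s - s'|) ->
  (forall s s', 0 <= s -> s <= s' -> s' <= 1 ->
     tau s <= tau s' /\ forall i, X s ord0 i <= X s' ord0 i) ->
  (forall s, 0 <= s <= 1 -> forall i,
     leftlim x (tau s) ord0 i <= X s ord0 i <= x (tau s) ord0 i) ->
  X 0 = x 0 -> tau 0 = 0 -> X 1 = x T -> tau 1 = T ->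
  weak_param_reps T x (fun s => (X s, tau s)).
Proof.
move=> XL tL mono Xb X0 t0 X1 t1; split.
- apply: (@lipschitz_within_continuous _ _ _ _ L) => s s' s01 s01'.
  by rewrite prod_normE ge_max /= XL// tL.
- move=> s s01; split => /=.
    have /andP[s0 s1] := s01.
    have [+ _] := mono _ _ (lexx 0) s0 s1; rewrite t0 => ->.
    by have [+ _] := mono _ _ s0 s1 (lexx 1); rewrite t1 => ->.
  move=> i; have /andP[h1 h2] := Xb s s01 i.
  by rewrite ge_min h1 le_max h2 orbT.
- move=> s s' s0 ss' s1; have [+ Xm] := mono _ _ s0 ss' s1.
  rewrite le_eqVlt => /predU1P[ts|]; last by left.
  right; split=> //= i; have [|h1 _] := andP (Xb s _ i).
    by rewrite s0 (le_trans ss').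
  have h2 := Xm i.
  by rewrite !ler0_norm ?subr_le0// ?(le_trans h1)//; lra.
- by rewrite X0 t0.
- by rewrite X1 t1.
Qed.

Lemma dw_ge0 x y : (0 <= dw T x y)%E.
Proof.
apply: le_ereal_inf_tmp => _ [pq _ <-]; rewrite le_max; apply/orP; left.
apply: le_ereal_sup_tmp; exists `|(pq.1 0).1 - (pq.2 0).1|%:E; last first.
  by rewrite lee_fin.
by exists 0 => //=; rewrite in_itv/= lexx ler01.
Qed.

Lemma dw_cvg0 (F : nat -> R -> 'rV[R]_m) y :
  (forall e, 0 < e -> \forall n \near \oo, (dw T (F n) y <= e%:E)%E) ->
  dw T (F n) y @[n --> \oo] --> 0%E.
Proof.
move=> h A /= [e /= e0 eA].
have e2 : 0 < e / 2 by rewrite divr_gt0.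
apply: filterS (h _ e2) => n dn; have d0 := dw_ge0 (F n) y.
rewrite /=; move: dn d0; case: dw => // d; rewrite !lee_fin => de d0.
by apply: eA => /=; rewrite sub0r normrN ger0_norm//; lra.
Qed.

Lemma cvg0_dw_lt (F : nat -> R -> 'rV[R]_m) y e : 0 < e ->
  dw T (F n) y @[n --> \oo] --> 0%E ->
  \forall n \near \oo, (dw T (F n) y < e%:E)%E.
Proof.
move=> e0 Fy; apply: (Fy [set d | (d < e%:E)%E]).
exists e => //= d /=; rewrite sub0r normrN lte_fin.
exact: le_lt_trans (ler_norm _).
Qed.

Lemma dw_le x y p q e : 0 <= e ->
  weak_param_reps T x p -> weak_param_reps T y q ->
  (forall s, 0 <= s <= 1 -> `|p s - q s| <= e) -> (dw T x y <= e%:E)%E.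
Proof.
move=> e0 xp yq pq; apply: ge_ereal_inf; eexists; first by exists (p, q).
rewrite /= ge_max; apply/andP; split; apply: ge_ereal_sup => _ [s /= s01 <-];
  rewrite in_itv/= in s01; rewrite lee_fin;
  by have := pq _ s01; rewrite prod_normE ge_max => /andP[].
Qed.

End graphs.

(** * Limits of rescaled paths *)

Lemma ordered_lipschitz {R : realType} {V : normedModType R} (f : R -> V)
    (a b L : R) :
  (forall s s', a <= s -> s <= s' -> s' <= b -> `|f s' - f s| <= L * (s' - s)) ->
  forall s s', a <= s <= b -> a <= s' <= b -> `|f s - f s'| <= L * `|s - s'|.
Proof.
move=> fL s s' /andP[as_ sb] /andP[as' sb'].
have [ss'|/ltW ss'] := leP s s'.
  by rewrite distrC (distrC s) (ger0_norm (x := s' - s)) ?subr_ge0// fL.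
by rewrite (ger0_norm (x := s - s')) ?subr_ge0// fL.
Qed.

Section lipschitz_pair.
Context {R : realType} {m : nat} (T C : R) (x : R -> 'rV[R]_m).
Hypothesis T_gt0 : 0 < T.
Hypothesis x_cadlag : cadlag T x.
Hypothesis x_bv : (path_variation x T <= C%:E)%E.

Let x_fin : (path_variation x T < +oo)%E := le_lt_trans x_bv (ltry C).

Lemma scaled_lipschitz_unif s s' : 0 <= s <= 1 -> 0 <= s' <= 1 ->
  `|scaled_path T x s - scaled_path T x s'| <= (T + C) * `|s - s'| /\
  `|scaled_time T x s - scaled_time T x s'| <= (T + C) * `|s - s'|.
Proof.
have KC : T + fine (path_variation x T) <= T + C.
  rewrite lerD2l -lee_fin fineK// (path_variation_fin x_fin)//.
  by rewrite (ltW T_gt0) lexx.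
by move=> s01 s01'; split; apply: (ordered_lipschitz (a := 0) (b := 1)) => //
  u v u0 uv v1; have [h1 h2] := scaled_lipschitz T_gt0 x_cadlag x_fin u0 uv v1;
  [apply: le_trans h1 _|apply: le_trans h2 _]; rewrite ler_wpM2r// subr_ge0.
Qed.

End lipschitz_pair.

(** * Rescaled pairs of nondecreasing paths *)

Section monotone_path.
Context {R : realType} {m : nat} (T : R) (x : R -> 'rV[R]_m).
Hypothesis T_gt0 : 0 < T.
Hypothesis x_cadlag : cadlag T x.
Hypothesis x_bv : (path_variation x T < +oo)%E.
Hypothesis x_homo : nondecreasing_path T x.

Let tau := scaled_time T x.
Let X := scaled_path T x.

Lemma leftlim_path_le t i : 0 <= t <= T -> leftlim x t ord0 i <= x t ord0 i.
Proof.
rewrite le_eqVlt => /andP[/predU1P[<-|t0] tT]; first by rewrite leftlim0.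
apply: (@ler_cvg_to _ t^'- _ _ (fun u => x u ord0 i) (cst (x t ord0 i))).
- by apply: cvg_row_coord; apply: (path_left_cvg x_cadlag); rewrite t0.
- exact: cvg_cst.
near=> u; apply: x_homo => //.
  by apply: ltW; near: u; exact: nbhs_left_gt.
Unshelve. all: by end_near. Qed.

Lemma path_le_leftlim u t i : 0 <= u -> u < t -> t <= T ->
  x u ord0 i <= leftlim x t ord0 i.
Proof.
move=> u0 ut tT.
apply: (@ler_cvg_to _ t^'- _ _ (cst (x u ord0 i)) (fun u => x u ord0 i)).
- exact: cvg_cst.
- by apply: cvg_row_coord; apply: (path_left_cvg x_cadlag); rewrite (le_lt_trans u0).
near=> v; apply: x_homo => //.
  by apply: ltW; near: v; exact: nbhs_left_gt.
by apply: le_trans tT; apply: ltW; near: v; exact: nbhs_left_lt.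
Unshelve. all: by end_near. Qed.

Lemma scaled_path_between s i : 0 <= s <= 1 ->
  leftlim x (tau s) ord0 i <= X s ord0 i <= x (tau s) ord0 i.
Proof.
move=> s01; have := leftlim_path_le i (scaled_time_itv x T_gt0 s).
have [l /andP[l0 l1]] := scaled_path_convex T_gt0 x_cadlag x_bv s01.
rewrite -/tau -/X => ->; rewrite !mxE.
move: (leftlim x (tau s) ord0 i) (x (tau s) ord0 i) => a b ab.
have h0 : 0 <= l * (b - a) by rewrite mulr_ge0// subr_ge0.
have h1 : 0 <= (1 - l) * (b - a) by rewrite mulr_ge0// subr_ge0.
by apply/andP; split; lra.
Qed.

(** At equal times the interpolation is monotone. Otherwise [X s] is below [x (tau s)], which is
    below the left limit at [tau s'], itself below [X s']. *)
Lemma scaled_path_homo s s' i : 0 <= s -> s <= s' -> s' <= 1 ->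
  X s ord0 i <= X s' ord0 i.
Proof.
move=> s0 ss' s1; have := scaled_time_homo x T_gt0 ss'; rewrite -/tau.
have s01 : 0 <= s <= 1 by rewrite s0 (le_trans ss').
have s01' : 0 <= s' <= 1 by rewrite s1 (le_trans s0).
have tT := scaled_time_itv x T_gt0 s; rewrite -/tau in tT.
rewrite le_eqVlt => /predU1P[tt'|tt'].
  rewrite /X !scaled_pathE -/tau -tt' !mxE lerD2l.
  apply: ler_wpM2r; first by rewrite subr_ge0 leftlim_path_le.
  apply: ler_wpM2r; last by rewrite lerD2r.
  by rewrite invr_ge0 (time_change_jump_ge0 T_gt0 x_cadlag x_bv).
have /andP[_ h1] := scaled_path_between i s01.
have /andP[h2 _] := scaled_path_between i s01'.
have /andP[_ tT'] := scaled_time_itv x T_gt0 s'.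
have /andP[t0 _] := tT.
by apply: le_trans h1 _; apply: le_trans h2; exact: path_le_leftlim.
Qed.

Lemma scaled_pair_weak_param_rep : weak_param_reps T x (scaled_pair T x).
Proof.
have lip := scaled_lipschitz_unif T_gt0 x_cadlag (C := fine (path_variation x T)).
have fin : path_variation x T \is a fin_num.
  by apply: (path_variation_fin x_bv); rewrite (ltW T_gt0) lexx.
rewrite fineK// lexx in lip.
apply: (monotone_weak_param_rep (L := T + fine (path_variation x T))).
- by move=> s s' s01 s01'; have [] := lip isT s s' s01 s01'.
- by move=> s s' s01 s01'; have [] := lip isT s s' s01 s01'.
- move=> s s' s0 ss' s1; split; first exact: scaled_time_homo.
  by move=> i; exact: scaled_path_homo.
- by move=> s s01 i; exact: scaled_path_between.
- exact: scaled_path0.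
- exact: scaled_time0.
- exact: scaled_path1.
- exact: scaled_time1.
Qed.

End monotone_path.

Section limit.
Context {R : realType} {m : nat} (T C : R) (x : nat -> R -> 'rV[R]_m).
Hypothesis T_gt0 : 0 < T.
Hypothesis x_cadlag : forall n, cadlag T (x n).
Hypothesis x_bv : forall n, (path_variation (x n) T <= C%:E)%E.
Variables (xhat : R -> 'rV[R]_m) (rhat : R -> R).
Hypothesis lim_unif : forall e, 0 < e -> \forall n \near \oo, forall s,
  0 <= s <= 1 -> `|xhat s - scaled_path T (x n) s| <= e /\
                 `|rhat s - scaled_time T (x n) s| <= e.

Let x_fin n : (path_variation (x n) T < +oo)%E := le_lt_trans (x_bv n) (ltry C).
Let r := generalized_inverse 1 rhat.

Let cvgX s : 0 <= s <= 1 -> scaled_path T (x n) s @[n --> \oo] --> xhat s.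
Proof.
move=> s01; apply/cvgrPdist_le => e /lim_unif; apply: filterS => n h.
by have [] := h _ s01.
Qed.

Let cvgt s : 0 <= s <= 1 -> scaled_time T (x n) s @[n --> \oo] --> rhat s.
Proof.
move=> s01; apply/cvgrPdist_le => e /lim_unif; apply: filterS => n h.
by have [] := h _ s01.
Qed.

Let in0 : 0 <= (0 : R) <= 1. Proof. by rewrite lexx ler01. Qed.
Let in1 : 0 <= (1 : R) <= 1. Proof. by rewrite lexx ler01. Qed.

Let L_gt0 : 0 < T + C.
Proof.
rewrite ltr_pwDl// -lee_fin (le_trans _ (x_bv 0))//.
by apply: path_variation_ge0; exact: ltW.
Qed.

Lemma limit_lipschitz s s' : 0 <= s <= 1 -> 0 <= s' <= 1 ->
  `|xhat s - xhat s'| <= (T + C) * `|s - s'| /\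
  `|rhat s - rhat s'| <= (T + C) * `|s - s'|.
Proof.
move=> s01 s01'; split.
- apply: (ler_cvg_to (cvg_norm (cvgB (cvgX s01) (cvgX s01'))) (cvg_cst _)).
  near=> n.
  by have [] := scaled_lipschitz_unif T_gt0 (x_cadlag n) (x_bv n) s01 s01'.
- apply: (ler_cvg_to (cvg_norm (cvgB (cvgt s01) (cvgt s01'))) (cvg_cst _)).
  near=> n.
  by have [] := scaled_lipschitz_unif T_gt0 (x_cadlag n) (x_bv n) s01 s01'.
Unshelve. all: by end_near. Qed.

Lemma limit_time_homo s s' : 0 <= s -> s <= s' -> s' <= 1 -> rhat s <= rhat s'.
Proof.
move=> s0 ss' s1.
have s01 : 0 <= s <= 1 by rewrite s0 (le_trans ss').
have s01' : 0 <= s' <= 1 by rewrite s1 (le_trans s0).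
apply: (ler_cvg_to (cvgt s01) (cvgt s01')).
by near=> n; apply: (scaled_time_homo _ T_gt0).
Unshelve. all: by end_near. Qed.

Lemma limit_time0 : rhat 0 = 0.
Proof.
apply: (cvg_unique _ (cvgt in0)) => //.
rewrite (_ : (fun n => _) = cst 0); first exact: cvg_cst.
by apply/funext => n; exact: scaled_time0.
Qed.

Lemma limit_time1 : rhat 1 = T.
Proof.
apply: (cvg_unique _ (cvgt in1)) => //.
rewrite (_ : (fun n => _) = cst T); first exact: cvg_cst.
by apply/funext => n; exact: scaled_time1.
Qed.

Lemma limit_path1 : x n T @[n --> \oo] --> xhat 1.
Proof.
have := cvgX in1; rewrite (_ : (fun n => _) = (fun n => x n T))//.
by apply/funext => n; exact: scaled_path1.
Qed.

Lemma limit_time_le s : 0 <= s <= 1 -> rhat s <= T.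
Proof.
by move=> /andP[s0 s1]; rewrite -limit_time1; exact: limit_time_homo.
Qed.

Let r_itv t : 0 <= r t <= 1.
Proof. exact: generalized_inverse_itv. Qed.

Let r_homo : {homo r : t t' / t <= t'}.
Proof. exact: generalized_inverse_homo. Qed.

Lemma limit_inverse1 : r T = 1.
Proof. by apply: generalized_inverse_max => // u; exact: limit_time_le. Qed.

(** Before [r t] the values of [rhat] are at most [t]; the Lipschitz bound carries this to [r t]
    itself. *)
Lemma limit_time_inverse t : 0 <= t -> rhat (r t) <= t.
Proof.
move=> t0; have /andP[] := r_itv t.
rewrite le_eqVlt => /predU1P[<- _|r0 r1]; first by rewrite limit_time0.
apply/ler_addgt0Pr => e e0.
have eL : 0 < e / (T + C) by rewrite divr_gt0.
near (r t)^'- => s.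
have s0 : 0 <= s by apply: ltW; near: s; exact: nbhs_left_gt.
have sr : s < r t by near: s; exact: nbhs_left_lt.
have : rhat s <= t by apply: (generalized_inverse_ge (b := 1)); rewrite ?s0.
have [|_] := @limit_lipschitz (r t) s (r_itv t).
  by rewrite s0 (le_trans (ltW sr)).
have : `|r t - s| < e / (T + C).
  near: s; exact: (@cvgr_dist_lt _ _ _ _ _ id (r t) (cvg_at_left_filter cvg_id)).
rewrite ltr_pdivlMr// mulrC => h1 h2 h3.
have := le_lt_trans h2 h1; rewrite ltr_norml => /andP[_]; lra.
Unshelve. all: by end_near. Qed.

Let r_lt1 t : 0 <= t < T -> r t < 1.
Proof.
move=> /andP[t0 tT]; have /andP[_] := r_itv t.
rewrite le_eqVlt => /predU1P[r1|//].
by have := limit_time_inverse t0; rewrite r1 limit_time1 leNgt tT.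
Qed.

(** Supplies parameters accumulating at [r t] whose time is strictly past [t], where [xhat] can be
    compared with the values of a path just after [t]. *)
Lemma limit_inverse_near t e : 0 <= t < T -> 0 < e ->
  exists s, [/\ 0 <= s <= 1, r t <= s < r t + e & t < rhat s].
Proof.
move=> tT e0; have r1 := r_lt1 tT; have /andP[r0 _] := r_itv t.
have [|v /andP[v1 v2] tv] :=
    @generalized_inverse_lt _ 1 rhat t ler01 (Num.min 1 (r t + e)).
  by rewrite ge_min lexx lt_min r1 ltrDl e0.
move: v2; rewrite lt_min => /andP[v2 v3].
by exists v; split => //; [rewrite (le_trans r0 v1) ltW|rewrite v1 v3].
Qed.

(** If [s < r t + e] and [t < rhat s], then every [u] in [[t, rhat s)] has [r u <= s]. *)
Lemma limit_inverse_right_continuous t : 0 <= t < T ->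
  r u @[u --> t^'+] --> r t.
Proof.
move=> tT; apply/cvgrPdist_lt => e e0.
have [s [s01 /andP[s1 s2] ts]] := limit_inverse_near tT e0.
near=> u.
have tu : t <= u by apply: ltW; near: u; exact: nbhs_right_gt.
have us : u < rhat s by near: u; exact: nbhs_right_lt.
have h1 := r_homo tu.
have h2 : r u <= s by apply: generalized_inverse_le.
rewrite distrC ger0_norm ?subr_ge0//; lra.
Unshelve. all: by end_near. Qed.

Lemma limit_comp_cvg (T' : Type) (F : set_system T') (f : T' -> R) (s : R) :
  Filter F ->
  (forall z, 0 <= f z <= 1) -> 0 <= s <= 1 -> f z @[z --> F] --> s ->
  xhat (f z) @[z --> F] --> xhat s.
Proof.
move=> FF f01 s01 fs; apply/cvgrPdist_le => e e0.
have eL : 0 < e / (T + C) by rewrite divr_gt0.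
apply: filterS ((cvgrPdist_lt _ _).1 fs _ eL) => z.
rewrite ltr_pdivlMr// mulrC => /ltW.
by have [h _] := limit_lipschitz s01 (f01 z); exact: le_trans h.
Qed.

(** [r] is nondecreasing and right-continuous, and [xhat] is Lipschitz. *)
Lemma limit_cadlag : cadlag T (xhat \o r).
Proof.
split=> [t tT|t /andP[t0 tT]].
  by apply: limit_comp_cvg => //; exact: limit_inverse_right_continuous.
have cr : cvg (r u @[u --> t^'-]).
  apply: nondecreasing_at_left_is_cvgr; near=> y.
    by move=> a b _ _; exact: r_homo.
  by exists 1 => _ [a _ <-]; have /andP[] := r_itv a.
apply/cvg_ex; exists (xhat (lim (r u @[u --> t^'-]))).
apply: limit_comp_cvg => //.
apply/andP; split.
  by apply: limr_ge => //; near=> u; have /andP[] := r_itv u.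
by apply: limr_le => //; near=> u; have /andP[] := r_itv u.
Unshelve. all: by end_near. Qed.

(** * Identification of the limit under WM1 convergence *)

Section identification.
Variable y : R -> 'rV[R]_m.
Hypothesis y_cadlag : cadlag T y.
Hypothesis xy : dw T (x n) y @[n --> \oo] --> 0%E.

(** For large [n], the value and the left limit of [x n] at the rescaled time of [s] are both within
    [e + eta] of [c] by [dw_path_near]; the rescaled path lies between them. *)
Let limit_near a b e c s : 0 < e -> 0 <= a -> b <= T ->
  (forall z u, a < u -> u < b -> thick_graph T y (z, u) -> `|z - c| <= e) ->
  0 <= s <= 1 -> a < rhat s < b -> `|xhat s - c| <= 2 * e.
Proof.
move=> e0 a0 bT yab s01 /andP[as_ sb].
(* One [eta] pays for the error on the rescaled time and another for the time shift in
   [dw_path_near], so a third of the distance to each end suffices. [eta <= e] gives the factor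
   2. *)
pose eta := Num.min e (Num.min ((rhat s - a) / 3) ((b - rhat s) / 3)).
have eta0 : 0 < eta.
  by rewrite !lt_min e0 !divr_gt0 ?subr_gt0.
have eta1 : eta <= e by rewrite ge_min lexx.
have eta2 : eta <= (rhat s - a) / 3 by rewrite !ge_min lexx orbT.
have eta3 : eta <= (b - rhat s) / 3 by rewrite !ge_min lexx !orbT.
apply: (ler_cvg_to (cvg_norm (cvgB (cvgX s01) (cvg_cst c))) (cvg_cst _)).
near=> n.
have tau_near : `|rhat s - scaled_time T (x n) s| < eta.
  by near: n; move/cvgrPdist_lt: (cvgt s01); exact.
have dwn : (dw T (x n) y < eta%:E)%E by near: n; exact: cvg0_dw_lt.
have near_c := dw_path_near (x_cadlag n) dwn bT yab.
have := scaled_path_convex T_gt0 (x_cadlag n) (x_fin n) s01.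
move: tau_near; set t := scaled_time T (x n) s; rewrite ltr_norml => /andP[t1 t2].
have tT := scaled_time_itv (x n) T_gt0 s; rewrite -/t in tT.
have xt : `|x n t - c| <= e + eta by apply: near_c; lra.
have lt : `|leftlim (x n) t - c| <= e + eta.
  apply: leftlim_dist; first exact: x_cadlag.
    by case/andP: tT => _ ->; rewrite andbT; lra.
  near=> u; apply: near_c.
  - by apply: ltW; near: u; apply: nbhs_left_gt; lra.
  - by near: u; apply: nbhs_left_gt; lra.
  - by apply: (@lt_trans _ _ t); [near: u; exact: nbhs_left_lt|lra].
move=> [l /andP[l0 l1] Xe].
change (`|scaled_path T (x n) s - c| <= 2 * e); rewrite Xe.
apply: le_trans (_ : e + eta <= _); last by lra.
apply: between_norm lt xt => i; rewrite !mxE.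
move: (leftlim (x n) t ord0 i) (x n t ord0 i) => p q.
have [pq|pq] := leP p q.
  have h0 : 0 <= l * (q - p) by rewrite mulr_ge0// subr_ge0.
  have h1 : 0 <= (1 - l) * (q - p) by rewrite mulr_ge0// subr_ge0.
  by apply/andP; split; lra.
have h0 : 0 <= l * (p - q) by rewrite mulr_ge0// subr_ge0 ltW.
have h1 : 0 <= (1 - l) * (p - q) by rewrite mulr_ge0// subr_ge0// ltW.
by apply/andP; split; lra.
Unshelve. all: by end_near. Qed.

Lemma limit_identification t : 0 <= t <= T -> xhat (r t) = y t.
Proof.
move=> /andP[t0]; rewrite le_eqVlt => /predU1P[->|tT].
  (* There is no time to the right of [T]: here the fixed endpoints of the representations give the
     convergence of [x n T] to [y T]. *)
  rewrite limit_inverse1; apply: (cvg_unique _ limit_path1) => //.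
  apply/cvgrPdist_le => e e0.
  have := cvg0_dw_lt e0 xy; apply: filterS => n /dw_path_end.
  by rewrite distrC.
apply/eqP; rewrite -subr_eq0 -normr_le0; apply/ler_addgt0Pr => e e0.
have e3 : 0 < e / 3 by rewrite divr_gt0.
have t0T : 0 <= t < T by rewrite t0.
have [d d0 yd] := thick_graph_right_near y_cadlag t0T e3.
pose b := Num.min (t + d) T.
have tb : t < b by rewrite lt_min tT ltrDl d0.
(* Moving from [r t] to [s] changes [xhat] by less than [e / 3] and keeps [rhat s] below [b];
   [limit_near] accounts for the other [2 * (e / 3)]. *)
pose k := Num.min (e / 3) (b - t).
have k0 : 0 < k by rewrite lt_min e3 subr_gt0.
have [|s [s01 /andP[s1 s2] ts]] := @limit_inverse_near t (k / (T + C)) t0T.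
  by rewrite divr_gt0.
have [h1 h2] := limit_lipschitz s01 (r_itv t).
have sk : (T + C) * `|s - r t| < k.
  by rewrite mulrC -ltr_pdivlMr// ger0_norm ?subr_ge0// ltrBlDl.
have {}h1 := le_lt_trans h1 sk; have {}h2 := le_lt_trans h2 sk.
have h3 := limit_time_inverse t0.
have sb : t < rhat s < b.
  rewrite ts /=; move: h2; rewrite lt_min ltr_norml => /andP[_ /ltr_normlP[_]]; lra.
have h4 : `|xhat s - y t| <= 2 * (e / 3).
  apply: limit_near sb => //; first by rewrite ge_min lexx orbT.
  by move=> z u tu; rewrite lt_min => /andP[ud _]; exact: yd.
move: h1; rewrite lt_min distrC => /andP[h1 _].
rewrite -(subrKA (xhat s)); apply: le_trans (ler_normD _ _) _.
lra.
Qed.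

End identification.

(** * Limit points of nondecreasing paths *)

Section monotone_limit.
Hypothesis x_homo : forall n, nondecreasing_path T (x n).
(** If [rhat] vanishes on an initial interval, then [r 0 > 0]. By the convention at [0-], the thick
    graph of [xhat \o r] has only the point [xhat (r 0)] at time 0, so a representation must start
    there. *)
Hypothesis xhat0 : xhat 0 = xhat (r 0).

Lemma limit_path_homo s s' i : 0 <= s -> s <= s' -> s' <= 1 ->
  xhat s ord0 i <= xhat s' ord0 i.
Proof.
move=> s0 ss' s1.
have s01 : 0 <= s <= 1 by rewrite s0 (le_trans ss').
have s01' : 0 <= s' <= 1 by rewrite s1 (le_trans s0).
apply: (@ler_cvg_to _ \oo _ _ (fun n => scaled_path T (x n) s ord0 i)
  (fun n => scaled_path T (x n) s' ord0 i)).
- exact: cvg_row_coord (cvgX s01).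
- exact: cvg_row_coord (cvgX s01').
by near=> n; apply: (scaled_path_homo T_gt0).
Unshelve. all: by end_near. Qed.

Lemma limit_weak_param_rep :
  weak_param_reps T (xhat \o r) (fun s => (xhat s, rhat s)).
Proof.
apply: (monotone_weak_param_rep (L := T + C)).
- by move=> s s' s01 s01'; have [] := limit_lipschitz s01 s01'.
- by move=> s s' s01 s01'; have [] := limit_lipschitz s01 s01'.
- move=> s s' s0 ss' s1; split; first exact: limit_time_homo.
  by move=> i; exact: limit_path_homo.
(* Upper bound: [s <= r (rhat s)], since a parameter before [s] cannot have a time beyond
   [rhat s]. *)
- move=> s /andP[s0 s1] i; apply/andP; split; last first.
    apply: limit_path_homo => //; last by have /andP[] := r_itv (rhat s).
    rewrite leNgt; apply/negP => rs.
    have [|v /andP[v1 vs]] := @generalized_inverse_lt _ 1 rhat (rhat s) ler01 s.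
      by rewrite rs.
    have /andP[v0 _] := r_itv (rhat s).
    by rewrite ltNge limit_time_homo ?(le_trans v0 v1)// ltW.
  (* Lower bound: for [u < rhat s] one has [r u <= s]; let [u] increase to [rhat s]. At time 0 the
     left limit is the value, and [xhat0] applies. *)
  have := limit_time_homo (lexx 0) s0 s1; rewrite limit_time0.
  rewrite le_eqVlt => /predU1P[t0|t0].
    by rewrite -t0 leftlim0 /= -xhat0 limit_path_homo.
  have tT : 0 < rhat s <= T by rewrite t0 limit_time_le// s0.
  have lc := leftlim_cvg t0 (limit_cadlag.2 _ tT).
  apply: (@ler_cvg_to _ (rhat s)^'- _ _ (fun u => (xhat \o r) u ord0 i)
    (cst (xhat s ord0 i))).
  - exact: cvg_row_coord lc.
  - exact: cvg_cst.
  near=> u.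
  apply: limit_path_homo => //; first by have /andP[] := r_itv u.
  apply: generalized_inverse_le => //; by rewrite s0.
- exact: xhat0.
- exact: limit_time0.
- by rewrite /= limit_inverse1.
- exact: limit_time1.
Unshelve. all: by end_near. Qed.

(** The rescaled pair of [x n] and the limit pair are admissible in the infimum defining [dw], and
    they converge uniformly. *)
Lemma limit_dw_cvg : dw T (x n) (xhat \o r) @[n --> \oo] --> 0%E.
Proof.
apply: dw_cvg0 => e e0; have := lim_unif e0; apply: filterS => n xn.
apply: (dw_le (ltW e0) _ limit_weak_param_rep).
  exact: scaled_pair_weak_param_rep.
move=> s s01; have [h1 h2] := xn _ s01.
by rewrite prod_normE ge_max /= distrC h1 distrC h2.
Qed.

End monotone_limit.

End limit.

(** * Uniform limits along subsequences and uniform bounds *)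

Lemma uniform_cvg_norm {R : realType} {V : normedModType R} (A : set R)
    (F : nat -> R -> V) (f : R -> V) e :
  {uniform A, F @ \oo --> f} -> 0 < e ->
  \forall n \near \oo, forall s, A s -> `|f s - F n s| <= e.
Proof.
move=> Ff e0; apply: (Ff [set g | forall s, A s -> `|f s - g s| <= e]).
apply/uniform_nbhs; exists [set pq | ball pq.1 e pq.2]; split.
  by rewrite -entourage_ballE; exists e.
move=> g /= fg s As; have := fg s As; rewrite -ball_normE /=.
exact: ltW.
Qed.

Lemma cvg_extraction (nk : nat -> nat) :
  {homo nk : j k / (j < k)%N} -> nk k @[k --> \oo] --> \oo.
Proof.
move=> nk_homo.
have nk_ge k : (k <= nk k)%N.
  by elim: k => // k ih; apply: leq_ltn_trans ih _; exact: nk_homo.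
by move=> A [N _ NA]; exists N => // k /= /leq_trans/(_ (nk_ge k)); exact: NA.
Qed.

(** Variation controls only the displacement from the starting value; [M] bounds that value.
    Together they give the compact range required by Ascoli's theorem. *)
Lemma scaled_pair_bounded {R : realType} {m : nat} (T C M : R)
    (x : R -> 'rV[R]_m) s : 0 < T -> cadlag T x ->
  (path_variation x T <= C%:E)%E -> `|x 0| <= M -> 0 <= s <= 1 ->
  `|scaled_pair T x s| <= T + C + M.
Proof.
move=> T0 cx xC xM s01; have /andP[s0 s1] := s01.
have M0 := le_trans (normr_ge0 _) xM.
have C0 : 0 <= C.
  by rewrite -lee_fin (le_trans _ xC)// path_variation_ge0// ltW.
have L0 : 0 <= T + C by rewrite addr_ge0// ltW.
rewrite prod_normE ge_max /=; apply/andP; split; last first.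
  have /andP[t0 tT] := scaled_time_itv x T0 s.
  by rewrite ger0_norm//; lra.
have [|h _] := scaled_lipschitz_unif T0 cx xC s01 (s' := 0).
  by rewrite lexx ler01.
rewrite (scaled_path0 T0 (le_lt_trans xC (ltry C))) subr0 (ger0_norm s0) in h.
rewrite -[scaled_path T x s](subrK (x 0)).
apply: le_trans (ler_normD _ _) _; apply: lerD => //.
by apply: le_trans h _; rewrite ler_piMr.
Qed.

Unset Implicit Arguments.

Theorem theorem3p1 (R : realType) (T : R) (m : nat) (x : nat -> R -> 'rV[R]_m)
    (T_gt0 : 0 < T)
    (x_cadlag : forall n, cadlag T (x n))
    (x_bv : (ereal_sup (range (fun n => path_variation (x n) T)) < +oo)%E) :
  (bounded_set (range (fun n => x n 0)) ->
   precompact (range (fun n => scaled_pair T (x n))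
               : set {uniform` `[0, 1]%classic -> ('rV[R]_m * R)%type})) /\
  (forall (nk : nat -> nat) (xhat : R -> 'rV[R]_m) (rhat : R -> R),
     {homo nk : j k / (j < k)%N} ->
     {uniform `[0, 1], (fun k => scaled_pair T (x (nk k))) @ \oo
                       --> (fun s => (xhat s, rhat s))} ->
     let r := generalized_inverse 1 rhat in
     (forall y : R -> 'rV[R]_m, cadlag T y ->
        dw T (x n) y @[n --> \oo] --> 0%E ->
        forall t, 0 <= t <= T -> (xhat \o r) t = y t) /\
     ((forall n, nondecreasing_path T (x n)) ->
        cadlag T (xhat \o r) /\
        (xhat 0 = (xhat \o r) 0 ->
           weak_param_reps T (xhat \o r) (fun s => (xhat s, rhat s)) /\
           dw T (x (nk k)) (xhat \o r) @[k --> \oo] --> 0%E))).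
Proof.
pose S := ereal_sup (range (fun n => path_variation (x n) T)).
have xS n : (path_variation (x n) T <= S)%E by apply: ereal_sup_ubound; exists n.
have S0 : (0 <= S)%E by rewrite (le_trans _ (xS 0%N))// path_variation_ge0// ltW.
have xC n : (path_variation (x n) T <= (fine S)%:E)%E.
  by rewrite fineK// ge0_fin_numE.
have L0 : 0 <= T + fine S by rewrite addr_ge0 ?fine_ge0// ltW.
split=> [[M [_ xM]]|nk xhat rhat nk_homo lim r].
  (* [bounded_set] provides a bound by every number larger than [M], hence by [M + 1]. *)
  apply: (lipschitz_precompact (L := T + fine S) ler01 L0
    (compact_norm_ball (c := T + fine S + (M + 1)))).
    move=> _ s [n _ <-] s01; apply: scaled_pair_bounded => //.
    by apply: xM; [rewrite ltrDl|exists n].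
  move=> _ s s' [n _ <-] s01 s01'; rewrite prod_normE ge_max /=.
  have [-> ->] := scaled_lipschitz_unif T_gt0 (x_cadlag n) (xC n) s01 s01'.
  by [].
have lim_unif e : 0 < e -> \forall k \near \oo, forall s, 0 <= s <= 1 ->
    `|xhat s - scaled_path T (x (nk k)) s| <= e /\
    `|rhat s - scaled_time T (x (nk k)) s| <= e.
  move=> e0; apply: filterS (uniform_cvg_norm lim e0) => k h s s01.
  by have := h s; rewrite /= in_itv/= prod_normE ge_max => /(_ s01)/andP[].
have cx k := x_cadlag (nk k); have bx k := xC (nk k).
split=> [y cy xy t tT|x_homo].
  apply: (limit_identification T_gt0 cx bx lim_unif cy) => //.
  exact: cvg_comp (cvg_extraction nk_homo) xy.
split; first exact: (limit_cadlag T_gt0 cx bx lim_unif).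
move=> xhat0; split.
  exact: (limit_weak_param_rep T_gt0 cx bx lim_unif).
exact: (limit_dw_cvg T_gt0 cx bx lim_unif).
Qed.
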